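(* Let $(A,\preccurlyeq,\to,S)$ be an arrow algebra and let $j:A\to A$ be a nucleus on it. Define $a\to_j b:=a\to jb$ for $a,b\in A$, and $S_j:=\{a\in A : ja\in S\}$. Then $A_j=(A,\preccurlyeq,\to_j,S_j)$ is also an arrow algebra. If $A$ is compatible with joins, then so is $A_j$.
   Context: An arrow structure is a complete poset $(A,\preccurlyeq)$ (infima $\bigwedge$, suprema $\bigvee$) with a binary operation $\to$ such that $a'\preccurlyeq a$ and $b\preccurlyeq b'$ imply $a\to b\preccurlyeq a'\to b'$. The operation $\to$ associates to the right and binds stronger than $\bigwedge$. A separator on it is a subset $S\subseteq A$ such that: (1) $a\in S$, $a\preccurlyeq b$ imply $b\in S$; (2) $a\to b\in S$ and $a\in S$ imply $b\in S$; (3) $S$ contains $$\mathbf k=\bigwedge_{a,b\in A}a\to b\to a,\qquad \mathbf s=\bigwedge_{a,b,c\in A}(a\to b\to c)\to(a\to b)\to(a\to c),$$ $$\mathbf a=\bigwedge_{x,I,(y_i)_{i\in I},(z_i)_{i\in I}}\Big(\bigwedge_{i\in I}x\to y_i\to z_i\Big)\to x\to\Big(\bigwedge_{i\in I}y_i\to z_i\Big),$$ where in $\mathbf a$ the infimum is over all $x\in A$, all sets $I$ and all $I$-indexed families in $A$ (equivalently, $\mathbf a=\bigwedge_{a\in A,\,B\subseteq \mathrm{Im}(\to)}(\bigwedge_{b\in B}a\to b)\to a\to\bigwedge_{b\in B}b$). An arrow algebra is an arrow structure together with a separator on it. It is compatible with joins if $(\bigvee_{b\in B}b)\to a=\bigwedge_{b\in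 B}(b\to a)$ for all $a\in A$ and $B\subseteq A$. A nucleus on an arrow algebra $(A,\preccurlyeq,\to,S)$ is a map $j:A\to A$ such that: (1) $a\preccurlyeq b$ implies $ja\preccurlyeq jb$; (2) $\bigwedge_{a\in A}a\to ja\in S$; (3) $\bigwedge_{a,b\in A}(a\to jb)\to(ja\to jb)\in S$. *)

(* Defs.v *)
From HB Require Import structures.
From mathcomp Require Import all_boot all_order.
From mathcomp Require Import boolp classical_sets.

Set Implicit Arguments.
Unset Strict Implicit.
Unset Printing Implicit Defensive.

Import Order.TTheory.
Local Open Scope classical_set_scope.
Local Open Scope order_scope.

HB.mixin Record POrder_isComplete d T of Order.POrder d T := {
  Inf : set T -> T;
  Sup : set T -> T;
  Inf_infimums : forall B : set T, infimums B (Inf B);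
  Sup_supremums : forall B : set T, supremums B (Sup B)
}.

#[short(type="completePOrderType")]
HB.structure Definition CompletePOrder d :=
  { T of Order.POrder d T & POrder_isComplete d T }.

Definition infi d (A : completePOrderType d) (I : Type) (f : I -> A) : A :=
  Inf (range f).

Section ArrowAlgebra.
Context {d : Order.disp_t} {A : completePOrderType d}.
Implicit Types (imp : A -> A -> A) (S B : set A) (j : A -> A).

Definition arrow_structure imp : Prop :=
  forall a a' b b' : A, a' <= a -> b <= b' -> imp a b <= imp a' b'.

Section Combinators.
Variable imp : A -> A -> A.
Local Notation "a ⇒ b" := (imp a b) (at level 55, right associativity).

Definition arr_k : A := Inf [set u | exists a b : A, u = a ⇒ b ⇒ a].

Definition arr_s : A :=
  Inf [set u | exists a b c : A, u = (a ⇒ b ⇒ c) ⇒ (a ⇒ b) ⇒ (a ⇒ c)].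

Definition arr_a : A :=
  Inf [set u | exists (x : A) (I : Type) (y z : I -> A),
    u = infi (fun i => x ⇒ y i ⇒ z i) ⇒ x ⇒ infi (fun i => y i ⇒ z i)].

End Combinators.

Record separator imp S : Prop := Separator {
  sep_up : forall a b : A, S a -> a <= b -> S b;
  sep_mp : forall a b : A, S (imp a b) -> S a -> S b;
  sep_k : S (arr_k imp);
  sep_s : S (arr_s imp);
  sep_a : S (arr_a imp)
}.

Record arrow_algebra imp S : Prop := ArrowAlgebra {
  arrow_algebra_structure : arrow_structure imp;
  arrow_algebra_separator : separator imp S
}.

Definition compatible_with_joins imp : Prop :=
  forall (a : A) B, imp (Sup B) a = Inf [set imp b a | b in B].

Record nucleus imp S j : Prop := Nucleus {
  nucleus_mono : forall a b : A, a <= b -> j a <= j b;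
  nucleus_unit : S (infi (fun a : A => imp a (j a)));
  nucleus_bind :
    S (Inf [set u | exists a b : A, u = imp (imp a (j b)) (imp (j a) (j b))])
}.

Definition nucleus_imp imp j (a b : A) : A := imp a (j b).

Definition nucleus_sep S j : set A := [set a | S (j a)].

End ArrowAlgebra.

(* Main.v *)
Require Import Defs.
From mathcomp Require Import all_boot all_order.
From mathcomp Require Import boolp classical_sets.

(** Monotonicity of [a -> j b] and its compatibility with joins are inherited
    from [imp], because the second argument is merely replaced by [j b]; upward
    closure of the new separator is monotonicity of [j].  What remains is a
    piece of logic: modus ponens and the three combinators for the Kleisli
    implication [a -> j b] of the monad-like operator [j].

    All of these are statements that a whole family of elements of [A] has a
    common lower bound in [S] ([realised]).  The combinators k, s, a of the
    original algebra make realised families closed under natural deduction for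
    minimal implicational logic ([hyp_app] is implication elimination,
    [hyp_here] and [weaken] give the hypotheses, introduction holds by
    definition of [entails]).  The combinator a enters because a lower bound
    has to be found for all instances at once: it moves an infimum of
    implications past a fixed premise, which gives a uniform modus ponens
    ([realised_mp]).  The axioms of a nucleus become the unit and bind rules of
    a lax modality ([lax_unit], [lax_bind]).  Inside this calculus the
    combinators k and s for [a -> j b] are the usual monadic programs.

    The combinator a for [a -> j b] also needs an infimum over the index set of
    each instance.  From the premise [x -> j (y i -> j (z i))] one derives
    [x -> y i -> j (z i)] uniformly in [i], because [j (y -> j z)] entails
    [y -> j z]; the original combinator a then collects these, first past the
    premise ([realised_infi]) and then past [x]. *)

Import Order.TTheory.
Local Open Scope classical_set_scope.
Local Open Scope order_scope.

Section ArrowCalculus.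

Set Implicit Arguments.
Unset Strict Implicit.

Context {d : Order.disp_t} {A : completePOrderType d}.

(** * Infima *)

Lemma Inf_le (B : set A) (b : A) : B b -> Inf B <= b.
Proof. by case: (Inf_infimums B) => lbB _; exact: lbB. Qed.

Lemma le_Inf (B : set A) (e : A) : (forall b, B b -> e <= b) -> e <= Inf B.
Proof. by case: (Inf_infimums B) => _ maxB leB; exact: maxB. Qed.

Lemma infi_le (I : Type) (f : I -> A) (i : I) : infi f <= f i.
Proof. by apply: Inf_le; exists i. Qed.

Lemma le_infi (I : Type) (f : I -> A) (e : A) :
  (forall i, e <= f i) -> e <= infi f.
Proof. by move=> lef; apply: le_Inf => _ [i _ <-]. Qed.

(** * Uniformly realised families *)

(** Membership of the infimum of [f] in an upward closed [S].  The infimum is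
    not mentioned so that [T] may be a large type, such as the type of all
    families in [A], whose universe lies above that of the index sets over
    which infima are taken. *)
Definition realised (S : set A) (T : Type) (f : T -> A) : Prop :=
  exists2 e, S e & forall t, e <= f t.

Context (imp : A -> A -> A) (S : set A) (algS : arrow_algebra imp S).

Let imp_le := arrow_algebra_structure algS.
Let sepS := arrow_algebra_separator algS.

Lemma realised_app (T : Type) (f : T -> A) (t : T) : realised S f -> S (f t).
Proof. by case=> e Se lef; exact: (sep_up sepS Se (lef t)). Qed.

Lemma realised_le (T : Type) (f g : T -> A) :
  realised S f -> (forall t, f t <= g t) -> realised S g.
Proof. by case=> e Se lef lefg; exists e => // t; exact: le_trans (lefg t). Qed.

(** Holds because [arr_a] moves the infimum of the implications [y -> z] past
    the common lower bound of the [x t].  This is why the conclusion must be a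
    family of implications. *)
Lemma realised_mp (T : Type) (x y z : T -> A) :
  realised S (fun t => imp (x t) (imp (y t) (z t))) -> realised S x ->
  realised S (fun t => imp (y t) (z t)).
Proof.
move=> [e Se lee] [e' Se' lee'].
(* Indexing by the values taken, not by [T], keeps the index set in the
   universe of [A]. *)
pose J := {p : A * A | exists t, p = (y t, z t)}.
pose yJ (p : J) := (sval p).1; pose zJ (p : J) := (sval p).2.
exists (infi (fun p => imp (yJ p) (zJ p))); last first.
  move=> t; have Pt : exists t', (y t, z t) = (y t', z t') by exists t.
  by have := infi_le (fun p => imp (yJ p) (zJ p)) (exist _ (y t, z t) Pt).
apply: (sep_mp sepS) Se'; apply: (sep_mp sepS); last first.
  apply: (sep_up sepS Se).
  apply: (@le_infi J (fun p => imp e' (imp (yJ p) (zJ p)))) => -[p [t pE]].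
  rewrite /yJ /zJ /= pE.
  by apply: le_trans (lee t) _; apply: imp_le.
by apply: (sep_up sepS (sep_a sepS)); apply: Inf_le; exists e', J, yJ, zJ.
Qed.

Definition fimp (T : Type) (f g : T -> A) : T -> A := fun t => imp (f t) (g t).

Lemma realised_k (T : Type) (x y : T -> A) :
  realised S (fimp x (fimp y x)).
Proof.
by exists (arr_k imp) => [|t]; [exact: sep_k | apply: Inf_le; exists (x t), (y t)].
Qed.

Lemma realised_s (T : Type) (x y z : T -> A) :
  realised S (fimp (fimp x (fimp y z)) (fimp (fimp x y) (fimp x z))).
Proof.
exists (arr_s imp) => [|t]; first exact: sep_s.
by apply: Inf_le; exists (x t), (y t), (z t).
Qed.

Lemma realised_a (T : Type) (I : T -> Type) (x : T -> A)
    (y z : forall t, I t -> A) :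
  realised S (fimp (fun t => infi (fun i => imp (x t) (imp (y t i) (z t i))))
                   (fimp x (fun t => infi (fun i => imp (y t i) (z t i))))).
Proof.
exists (arr_a imp) => [|t]; first exact: sep_a.
by apply: Inf_le; exists (x t), (I t), (y t), (z t).
Qed.

(** A bound uniform in [t] and [i] is in particular a bound of the infimum over
    [i]; the combinator a moves that infimum past the premise [p t]. *)
Lemma realised_infi (T : Type) (I : T -> Type) (p : T -> A)
    (y z : forall t, I t -> A) :
  realised S (fun u : {t : T & I t} =>
    imp (p (tag u)) (imp (y _ (tagged u)) (z _ (tagged u)))) ->
  realised S (fimp p (fun t => infi (fun i => imp (y t i) (z t i)))).
Proof.
move=> [e Se lee]; apply: realised_mp (realised_a p y z) _.
by exists e => // t; apply: le_infi => i; exact: lee (existT _ t i).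
Qed.

(** * Natural deduction *)

(** The most recent hypothesis is the head of [G], so that implication
    introduction is an identity: [entails (x :: G) f] unfolds to
    [entails G (fimp x f)]. *)
Definition entails (T : Type) (G : seq (T -> A)) (f : T -> A) : Prop :=
  realised S (foldl (fun g x => fimp x g) f G).

Lemma closed_entails (T : Type) (G : seq (T -> A)) (f : T -> A) :
  realised S f -> entails G f.
Proof.
rewrite /entails => rf; elim/last_ind: G => [|G x IHG] //=.
by rewrite foldl_rcons; apply: realised_mp IHG; exact: realised_k.
Qed.

(** A context with at least one hypothesis is required because the uniform
    modus ponens only concludes families of implications. *)
Lemma hyp_app (T : Type) (G : seq (T -> A)) (x f g : T -> A) :
  entails (x :: G) (fimp f g) -> entails (x :: G) f -> entails (x :: G) g.
Proof.
elim: G x f g => [|y G IHG] x f g.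
  by move=> fg; apply: realised_mp; exact: realised_mp (realised_s x f g) fg.
move=> fg; apply: (IHG y (fimp x f) (fimp x g)).
exact: (IHG y _ _ (closed_entails (y :: G) (realised_s x f g)) fg).
Qed.

Lemma weaken (T : Type) (G : seq (T -> A)) (x f : T -> A) :
  entails G f -> entails (x :: G) f.
Proof.
case: G => [|y G] Gf; first exact: closed_entails.
change (entails (y :: G) (fimp x f)).
exact: hyp_app (closed_entails _ (realised_k f x)) Gf.
Qed.

Lemma hyp_here (T : Type) (G : seq (T -> A)) (x : T -> A) : entails (x :: G) x.
Proof.
apply: (closed_entails G (f := fimp x x)).
(* The identity is the combinator s k k. *)
apply: realised_mp (realised_k x x).
exact: realised_mp (realised_s x (fimp x x) x) (realised_k x (fimp x x)).
Qed.

(** * The nucleus as a lax modality *)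

Context (j : A -> A) (nucj : nucleus imp S j).

Definition fnuc (T : Type) (f : T -> A) : T -> A := fun t => j (f t).

Lemma lax_unit (T : Type) (G : seq (T -> A)) (x f : T -> A) :
  entails (x :: G) f -> entails (x :: G) (fnuc f).
Proof.
apply: hyp_app; apply: closed_entails.
exists (infi (fun a => imp a (j a))) => [|t]; first exact: nucleus_unit nucj.
exact: (infi_le (fun a => imp a (j a))).
Qed.

Lemma lax_bind (T : Type) (G : seq (T -> A)) (x f g : T -> A) :
  entails (x :: G) (fnuc f) -> entails (f :: x :: G) (fnuc g) ->
  entails (x :: G) (fnuc g).
Proof.
move=> jf fjg; apply: (hyp_app _ jf).
apply: (@hyp_app _ G x (fimp f (fnuc g))) fjg; apply: closed_entails.
eexists; first exact: nucleus_bind nucj.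
by move=> t; apply: Inf_le; exists (f t), (g t).
Qed.

(** Reduces the combinators of the Kleisli implication to derivations without an
    outermost [j]. *)
Lemma nucleus_sep_sub (a : A) : S a -> nucleus_sep S j a.
Proof.
move=> Sa; apply: (sep_mp sepS) Sa.
apply: (sep_up sepS (nucleus_unit nucj)).
exact: (infi_le (fun a => imp a (j a))).
Qed.

(** * The combinators of the Kleisli implication *)

(** The derivation of [j b] from [j a] and [j (a -> j b)] binds twice; a family
    indexed by [unit] turns it into two uses of modus ponens in [S]. *)
Lemma nucleus_sep_mp (a b : A) :
  nucleus_sep S j (nucleus_imp imp j a b) -> nucleus_sep S j a ->
  nucleus_sep S j b.
Proof.
rewrite /nucleus_sep /nucleus_imp /=.
move=> jab ja; apply: (sep_mp sepS) ja; apply: (sep_mp sepS) jab.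
pose fa (_ : unit) := a; pose fb (_ : unit) := b.
have : entails [:: fnuc fa; fnuc (fimp fa (fnuc fb))] (fnuc fb).
  apply: lax_bind (hyp_here _ _) _.
  apply: (@lax_bind _ _ _ (fimp fa (fnuc fb))).
    by do 2!apply: weaken; exact: hyp_here.
  apply: hyp_app (hyp_here _ _) _.
  by apply: weaken; exact: hyp_here.
exact: (realised_app tt).
Qed.

Lemma nucleus_sep_k : nucleus_sep S j (arr_k (nucleus_imp imp j)).
Proof.
apply: nucleus_sep_sub.
pose fa (t : A * A) := t.1; pose fb (t : A * A) := t.2.
have : entails [:: fa] (fnuc (fimp fb (fnuc fa))).
  apply: lax_unit.
  change (entails [:: fb; fa] (fnuc fa)).
  by apply: lax_unit; apply: weaken; exact: hyp_here.
case=> e Se lee; apply: (sep_up sepS Se).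
by apply: le_Inf => _ [a [b ->]]; exact: (lee (a, b)).
Qed.

Lemma nucleus_sep_s : nucleus_sep S j (arr_s (nucleus_imp imp j)).
Proof.
apply: nucleus_sep_sub.
pose fa (t : A * A * A) := t.1.1; pose fb (t : A * A * A) := t.1.2.
pose fc (t : A * A * A) := t.2.
pose bc := fimp fb (fnuc fc); pose ab := fimp fa (fnuc fb).
have : entails [:: fimp fa (fnuc bc)]
         (fnuc (fimp ab (fnuc (fimp fa (fnuc fc))))).
  apply: lax_unit.
  change (entails [:: ab; fimp fa (fnuc bc)] (fnuc (fimp fa (fnuc fc)))).
  apply: lax_unit.
  change (entails [:: fa; ab; fimp fa (fnuc bc)] (fnuc fc)).
  apply: (@lax_bind _ _ _ bc).
    apply: hyp_app (hyp_here _ _).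
    by do 2!apply: weaken; exact: hyp_here.
  apply: (@lax_bind _ _ _ fb).
    apply: (@hyp_app _ _ _ fa); last by apply: weaken; exact: hyp_here.
    by do 2!apply: weaken; exact: hyp_here.
  apply: hyp_app (hyp_here _ _).
  by apply: weaken; exact: hyp_here.
case=> e Se lee; apply: (sep_up sepS Se).
by apply: le_Inf => _ [a [b [c ->]]]; exact: (lee (a, b, c)).
Qed.

(** The data over which the infimum in [arr_a] ranges, bundled so that a
    realised family can be indexed by it. *)
Record instance_a := InstanceA {
  prem : A;
  idx : Type;
  src : idx -> A;
  tgt : idx -> A
}.

(** The premise is first brought to the form that the original combinator a
    accepts: [r] is [p] without the [j] before [src i -> j (tgt i)].  Removing it is sound because
    the conclusion [j (tgt i)] is again in the image of [j], so it can absorb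
    the bind. *)
Lemma nucleus_sep_a : nucleus_sep S j (arr_a (nucleus_imp imp j)).
Proof.
apply: nucleus_sep_sub.
pose T := instance_a; pose x : T -> A := prem.
pose w (t : T) (i : idx t) := imp (src i) (j (tgt i)).
pose p (t : T) := infi (fun i : idx t => imp (x t) (j (w t i))).
pose q (t : T) := infi (w t).
pose r (t : T) := infi (fun i : idx t => imp (x t) (w t i)).
have pr : entails [:: p] r.
  (* The index [i] is made part of the index of the family, so that the
     derivation is uniform in it. *)
  pose U := {t : T & idx t}.
  pose pU (u : U) := p (tag u); pose xU (u : U) := x (tag u).
  pose yU (u : U) := src (tagged u); pose zU (u : U) := tgt (tagged u).
  pose wU := fimp yU (fnuc zU).
  have pxw : entails [:: pU] (fimp xU (fnuc wU)).
    apply: (realised_le (hyp_here [::] pU)) => u; apply: imp_le => //.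
    exact: (infi_le (fun i : idx (tag u) => imp (x (tag u)) (j (w (tag u) i)))).
  have : entails [:: yU; xU; pU] (fnuc zU).
    apply: (@lax_bind _ _ _ wU).
      apply: (@hyp_app _ _ _ xU); last by apply: weaken; exact: hyp_here.
      by do 2!apply: weaken.
    apply: hyp_app (hyp_here _ _) _.
    by apply: weaken; exact: hyp_here.
  exact: (@realised_infi T idx p (fun t _ => x t) w).
have : entails [:: p] (fnuc (fimp x (fnuc q))).
  apply: lax_unit.
  change (entails [:: x; p] (fnuc q)).
  apply: lax_unit.
  change (entails [:: p] (fimp x q)).
  apply: (hyp_app _ pr); apply: closed_entails.
  exact: (realised_a x (fun t i => src i) (fun t i => j (tgt i))).
case=> e Se lee; apply: (sep_up sepS Se).
by apply: le_Inf => _ [a [I [y [z ->]]]]; exact: (lee (InstanceA a y z)).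
Qed.

Lemma nucleus_separator : separator (nucleus_imp imp j) (nucleus_sep S j).
Proof.
split; last 4 first.
- exact: nucleus_sep_mp.
- exact: nucleus_sep_k.
- exact: nucleus_sep_s.
- exact: nucleus_sep_a.
by move=> a b Sja leab; exact: (sep_up sepS Sja (nucleus_mono nucj leab)).
Qed.

End ArrowCalculus.

Theorem proposition3p15 (d : Order.disp_t) (A : completePOrderType d)
    (imp : A -> A -> A) (S : set A) (j : A -> A) :
  arrow_algebra imp S ->
  nucleus imp S j ->
  arrow_algebra (nucleus_imp imp j) (nucleus_sep S j) /\
  (compatible_with_joins imp -> compatible_with_joins (nucleus_imp imp j)).
Proof.
move=> algS nucj; split; last by move=> joins a B; exact: joins.
split; last exact: (nucleus_separator algS nucj).
move=> a a' b b' lea leb.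
exact: (arrow_algebra_structure algS lea (nucleus_mono nucj leb)).
Qed.
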